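(* Let $\theta>0$ and $\varepsilon\in(0,1)$. Let $M\ge1$ and, for each $m\in\{1,\dots,M\}$, let $\mathbf{a}_m\in\mathbb{R}^L$, $\mathbf{b}_m\in\mathbb{R}^K$ with $\mathbf{b}_m\ne\mathbf{0}$, and $b_m\in\mathbb{R}$. For the safety set $\mathcal{S}(\mathbf{x})=\{\boldsymbol{\xi}\in\mathbb{R}^K\mid\mathbf{a}_m^\top\mathbf{x}<\mathbf{b}_m^\top\boldsymbol{\xi}+b_m\ \forall m\in\{1,\dots,M\}\}$, the distributionally robust chance constrained program $$\min_{\mathbf{x}\in\mathcal{X}}\ \mathbf{c}^\top\mathbf{x}\quad\text{s.t.}\quad\mathbb{P}[\tilde{\boldsymbol{\xi}}\in\mathcal{S}(\mathbf{x})]\ge1-\varepsilon\quad\forall\,\mathbb{P}\in\mathcal{F}(\theta)$$ is equivalent to the mixed integer conic program $$\begin{array}{cll}\displaystyle\min_{\mathbf{q},\mathbf{s},t,\mathbf{x}}&\mathbf{c}^\top\mathbf{x}\\ \text{s.t.}&\varepsilon Nt-\mathbf{e}^\top\mathbf{s}\ge\theta N\\ &\dfrac{\mathbf{b}_m^\top\hat{\boldsymbol{\xi}}_i+b_m-\mathbf{a}_m^\top\mathbf{x}}{\|\mathbf{b}_m\|_*}+\mathrm{M}q_i\ge t-s_i&\forall m\in\{1,\dots,M\},\ i\in\{1,\dots,N\}\\ &\mathrm{M}(1-q_i)\ge t-s_i&\forall i\in\{1,\dots,N\}\\ &\mathbf{q}\in\{0,1\}^N,\ \mathbf{s}\ge\mathbf{0},\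 \mathbf{x}\in\mathcal{X},\end{array}$$ with variables $\mathbf{q},\mathbf{s}\in\mathbb{R}^N$, $t\in\mathbb{R}$, $\mathbf{x}\in\mathbb{R}^L$, where $\mathrm{M}$ (upright; not the number $M$ of safety conditions) is a suitably large (but finite) positive constant.
   Context: Setting. $\|\cdot\|$ is an arbitrary norm on $\mathbb{R}^K$ with dual norm $\|\cdot\|_*$, and $\mathcal{P}(\mathbb{R}^K)$ is the set of all probability distributions on $\mathbb{R}^K$. For $\mathbb{P}_1,\mathbb{P}_2\in\mathcal{P}(\mathbb{R}^K)$ the (type-1) Wasserstein distance is $d_{\rm W}(\mathbb{P}_1,\mathbb{P}_2)=\inf_{\mathbb{P}\in\mathcal{P}(\mathbb{P}_1,\mathbb{P}_2)}\mathbb{E}_{\mathbb{P}}[\|\tilde{\boldsymbol{\xi}}_1-\tilde{\boldsymbol{\xi}}_2\|]$, where $\mathcal{P}(\mathbb{P}_1,\mathbb{P}_2)$ is the set of all distributions of $(\tilde{\boldsymbol{\xi}}_1,\tilde{\boldsymbol{\xi}}_2)$ on $\mathbb{R}^K\times\mathbb{R}^K$ with marginals $\mathbb{P}_1$ and $\mathbb{P}_2$. Given training samples $\hat{\boldsymbol{\xi}}_1,\dots,\hat{\boldsymbol{\xi}}_N\in\mathbb{R}^K$ ($N\ge1$), let $\hat{\mathbb{P}}=\frac1N\sum_{i=1}^N\delta_{\hat{\boldsymbol{\xi}}_i}$ be the empirical distribution, and define the Wasserstein ambiguity set $\mathcal{F}(\theta)=\{\mathbb{P}\in\mathcal{P}(\mathbb{R}^K)\mid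 d_{\rm W}(\mathbb{P},\hat{\mathbb{P}})\le\theta\}$. $\mathcal{X}\subseteq\mathbb{R}^L$ is a compact polyhedron and $\mathbf{c}\in\mathbb{R}^L$. $\mathbf{e}$ is the all-ones vector, $\mathbf{0}$ the zero vector, and vector inequalities are componentwise. Note that $\mathbf{b}_m$ (vector) and $b_m$ (scalar) are different objects. ''Equivalent, where $\mathrm{M}$ is a suitably large (but finite) positive constant'' means: there is a finite constant $\mathrm{M}_0>0$ such that for every $\mathrm{M}\ge\mathrm{M}_0$, a decision $\mathbf{x}$ is feasible in the chance constrained program if and only if there exist $(\mathbf{q},\mathbf{s},t)$ such that $(\mathbf{q},\mathbf{s},t,\mathbf{x})$ is feasible in the mixed integer conic program (so that, the objectives being identical, optimal values and optimal decisions $\mathbf{x}$ coincide). *)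

(* Defs.v *)
(* R^n is ['rV[R]_n] for an arbitrary [R : realType]. *)
From HB Require Import structures.
From mathcomp Require Import all_boot all_order all_algebra.
From mathcomp Require Import all_classical all_reals all_analysis.

Set Implicit Arguments.
Unset Strict Implicit.
Unset Printing Implicit Defensive.

Import Order.TTheory GRing.Theory Num.Theory.
Import numFieldNormedType.Exports.

Local Open Scope classical_set_scope.
Local Open Scope ring_scope.

Definition dotv (R : realType) (n : nat) (u v : 'rV[R]_n) : R :=
  \sum_(i < n) u ord0 i * v ord0 i.

Definition is_norm (R : realType) (n : nat) (nrm : 'rV[R]_n -> R) : Prop :=
  [/\ forall x, 0 <= nrm x,
      forall x, nrm x = 0 -> x = 0,
      forall (a : R) x, nrm (a *: x) = `|a| * nrm x
    & forall x y, nrm (x + y) <= nrm x + nrm y].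

Definition dual_norm (R : realType) (n : nat) (nrm : 'rV[R]_n -> R)
    (y : 'rV[R]_n) : R :=
  sup [set dotv y x | x in [set x | nrm x <= 1]].

Definition polyhedron (R : realType) (n : nat) (X : set 'rV[R]_n) : Prop :=
  exists (p : nat) (A : 'M[R]_(p, n)) (d : 'I_p -> R),
    X = [set x | forall i : 'I_p, dotv (row i A) x <= d i].

(* R^n with its Borel sigma-algebra.  ['rV[R]_n] carries the topology of the
   sup norm, which is the topology of every norm on R^n. *)
Definition borel_space (R : realType) (n : nat) :
    measurableType (@open 'rV[R]_n).-sigma :=
  g_sigma_algebraType (@open 'rV[R]_n).

(* The product sigma-algebra of two copies of [borel_space R n] is the Borel
   sigma-algebra of R^n x R^n, as R^n is second countable. *)
Definition couplings (R : realType) (n : nat)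
    (P1 P2 : probability (borel_space R n) R) :
    set (probability (borel_space R n * borel_space R n)%type R) :=
  [set pi | forall A : set (borel_space R n), measurable A ->
      pushforward pi fst A = P1 A /\ pushforward pi snd A = P2 A].

Definition wasserstein (R : realType) (n : nat) (nrm : 'rV[R]_n -> R)
    (P1 P2 : probability (borel_space R n) R) : \bar R :=
  ereal_inf [set 'E_pi[fun z => nrm ((z.1 : 'rV[R]_n) - (z.2 : 'rV[R]_n))%R]%E
            | pi in couplings P1 P2].

(* The proof that the sample is nonempty is an argument so that the empirical
   distribution is a probability. *)
Definition empirical (R : realType) (n N : nat) (N0 : (0 < N)%N)
    (xihat : 'I_N -> 'rV[R]_n) : set (borel_space R n) -> \bar R :=
  fun A => ((N%:R^-1)%:E * \sum_(i < N) (\d_(xihat i : borel_space R n) A))%E.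

Lemma empirical_mscale (R : realType) (n N : nat) (N0 : (0 < N)%N)
    (xihat : 'I_N -> 'rV[R]_n) :
  empirical N0 xihat =
  mscale (NngNum (eqbRL (invr_ge0 N%:R) (ler0n R N)))
    (msum (fun k => \d_(xihat (insubd (Ordinal N0) k) : borel_space R n)) N).
Proof.
apply/funext => A; rewrite /empirical /mscale /msum /=; congr (_ * _)%E.
by apply: eq_bigr => i _; rewrite valKd.
Qed.

Lemma empirical0 (R : realType) (n N : nat) (N0 : (0 < N)%N)
    (xihat : 'I_N -> 'rV[R]_n) : empirical N0 xihat set0 = 0%E.
Proof. by rewrite empirical_mscale measure0. Qed.

Lemma empirical_ge0 (R : realType) (n N : nat) (N0 : (0 < N)%N)
    (xihat : 'I_N -> 'rV[R]_n) A : (0 <= empirical N0 xihat A)%E.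
Proof. by rewrite empirical_mscale measure_ge0. Qed.

Lemma empirical_sigma_additive (R : realType) (n N : nat) (N0 : (0 < N)%N)
    (xihat : 'I_N -> 'rV[R]_n) : semi_sigma_additive (empirical N0 xihat).
Proof. by rewrite empirical_mscale; exact: measure_semi_sigma_additive. Qed.

HB.instance Definition _ (R : realType) (n N : nat) (N0 : (0 < N)%N)
    (xihat : 'I_N -> 'rV[R]_n) :=
  isMeasure.Build _ _ _ (empirical N0 xihat) (empirical0 N0 xihat)
    (empirical_ge0 N0 xihat) (@empirical_sigma_additive _ _ _ N0 xihat).

Lemma empirical_setT (R : realType) (n N : nat) (N0 : (0 < N)%N)
    (xihat : 'I_N -> 'rV[R]_n) : empirical N0 xihat setT = 1%E.
Proof.
rewrite /empirical; under eq_bigr do rewrite diracT.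
rewrite sumEFin sumr_const card_ord -EFinM mulVf//.
by rewrite pnatr_eq0 -lt0n.
Qed.

HB.instance Definition _ (R : realType) (n N : nat) (N0 : (0 < N)%N)
    (xihat : 'I_N -> 'rV[R]_n) :=
  Measure_isProbability.Build _ _ _ (empirical N0 xihat)
    (empirical_setT N0 xihat).

Definition ambiguity_set (R : realType) (n N : nat) (nrm : 'rV[R]_n -> R)
    (N0 : (0 < N)%N) (xihat : 'I_N -> 'rV[R]_n) (theta : R) :
    set (probability (borel_space R n) R) :=
  [set P | (wasserstein nrm P (empirical N0 xihat) <= theta%:E)%E].

Definition safety_set (R : realType) (K L M : nat) (a : 'I_M -> 'rV[R]_L)
    (b : 'I_M -> 'rV[R]_K) (beta : 'I_M -> R) (x : 'rV[R]_L) :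
    set (borel_space R K) :=
  [set xi | forall m : 'I_M, dotv (a m) x < dotv (b m) xi + beta m].

Definition ccp_feasible (R : realType) (K L N M : nat) (nrm : 'rV[R]_K -> R)
    (N0 : (0 < N)%N) (xihat : 'I_N -> 'rV[R]_K) (X : set 'rV[R]_L)
    (theta eps : R) (a : 'I_M -> 'rV[R]_L) (b : 'I_M -> 'rV[R]_K)
    (beta : 'I_M -> R) : set 'rV[R]_L :=
  [set x | X x /\
    forall P : probability (borel_space R K) R,
      ambiguity_set nrm N0 xihat theta P ->
      ((1 - eps)%:E <= P (safety_set a b beta x))%E].

Record mip_vars (R : realType) (L N : nat) := MipVars {
  mip_q : 'rV[R]_N ; mip_s : 'rV[R]_N ; mip_t : R ; mip_x : 'rV[R]_L }.

Definition mip_feasible (R : realType) (K L N M : nat) (nrm : 'rV[R]_K -> R)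
    (xihat : 'I_N -> 'rV[R]_K) (X : set 'rV[R]_L) (theta eps : R)
    (a : 'I_M -> 'rV[R]_L) (b : 'I_M -> 'rV[R]_K) (beta : 'I_M -> R)
    (bigM : R) : set (mip_vars R L N) :=
  [set z | let: MipVars q s t x := z in
    [/\ eps * N%:R * t - \sum_(i < N) s ord0 i >= theta * N%:R,
        forall (m : 'I_M) (i : 'I_N),
          (dotv (b m) (xihat i) + beta m - dotv (a m) x) / dual_norm nrm (b m)
            + bigM * q ord0 i >= t - s ord0 i,
        forall i : 'I_N, bigM * (1 - q ord0 i) >= t - s ord0 i,
        forall i : 'I_N, q ord0 i = 0 \/ q ord0 i = 1
      & (forall i : 'I_N, 0 <= s ord0 i) /\ X x]].

(* Optimal value of min { f z | z in F }; it is +oo when F is empty. *)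
Definition optimal_value (R : realType) (T : Type) (F : set T) (f : T -> R) :
    \bar R :=
  ereal_inf [set (f z)%:E | z in F].

Definition optimal_solution (R : realType) (T : Type) (F : set T) (f : T -> R) :
    set T :=
  [set z | F z /\ forall z', F z' -> f z <= f z'].

(* Main.v *)
Require Import Defs.
From HB Require Import structures.
From mathcomp Require Import all_boot all_order all_algebra.
From mathcomp Require Import all_classical all_reals all_analysis.
From mathcomp Require Import measurable_realfun ring lra.
Import Order.TTheory GRing.Theory Num.Theory.
Import numFieldNormedType.Exports.
Local Open Scope classical_set_scope.
Local Open Scope ring_scope.

(** For a fixed decision [x], let [d(xi)] be the distance from [xi] to the closed
    unsafe set [U], the complement of the safety set. As [U] is a union of
    half-spaces, [d(xi)] is the positive part of the least margin
    [(b_m . xi + beta_m - a_m . x) / ||b_m||_*] ([unsafe_dist_lb] and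
    [unsafe_dist_approx]). The chance constraint bounds [P U] by [eps] over a
    Wasserstein ball around the empirical distribution, and an adversary who wants
    to violate it faces a fractional knapsack problem: moving a share [w_i] of the
    atom at the [i]-th sample into [U] costs [w_i d_i / N], where [d_i] is the
    distance of that sample, and the budget is [theta]. Linear programming duality
    turns the failure of the adversary into the existence of [t] and [s >= 0] with
      [eps N t - sum_i s_i >= theta N]  and  [t - s_i <= d_i]  for all [i];
    this is [ccp_feasibleE].

    Given [(t, s)], put [g(xi) = max(0, t - d(xi))]. Every [z1] in [U] and every
    [z2] satisfy [t <= ||z1 - z2|| + g(z2)]; integrating against a coupling of [P]
    with the empirical distribution yields [t P(U) <= cost + eps t - theta], hence
    [P U <= eps] once the infimum over couplings is taken
    ([unsafe_probability_le]). Here [theta > 0] forces [t > 0].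

    If no [(t, s)] exists, an optimal knapsack solution loads exactly [eps N] at a
    cost strictly below [theta N] ([knapsack_strong_duality]). Since [eps < 1], the
    strict slack pays for a slightly larger load ([knapsack_overload]) and also for
    replacing the distance to [U] by a nearly optimal displacement. The resulting
    finitely supported distribution lies in the ball and gives [U] mass above [eps]
    ([unsafe_probability_gt]).

    It remains to express [t - s_i <= d_i], where [d_i] is the maximum of [0] and a
    minimum of affine functions of [x], by linear constraints. The binary variable
    [q_i] selects which of the two arguments of the maximum is used. Compactness of
    the set of decisions bounds all the margins, and any such bound is an admissible
    big-M constant ([mip_feasibleE]). *)

(** * The scalar product and norms of R^n *)

Section Dot.
Context {R : realType} {n : nat}.
Implicit Types (u v w : 'rV[R]_n) (k : R).

Lemma dotvDr u v w : dotv u (v + w) = dotv u v + dotv u w.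
Proof.
by rewrite /dotv -big_split; apply: eq_bigr => i _; rewrite mxE mulrDr.
Qed.

Lemma dotvZr u k v : dotv u (k *: v) = k * dotv u v.
Proof.
by rewrite /dotv mulr_sumr; apply: eq_bigr => i _; rewrite mxE mulrCA.
Qed.

Lemma dotvNr u v : dotv u (- v) = - dotv u v.
Proof. by rewrite -scaleN1r dotvZr mulN1r. Qed.

Lemma dotv_gt0 u : u != 0 -> 0 < dotv u u.
Proof.
move=> u0; rewrite lt_def sumr_ge0 ?andbT; last first.
  by move=> i _; rewrite -expr2 sqr_ge0.
apply: contra u0; rewrite psumr_eq0; last first.
  by move=> i _; rewrite -expr2 sqr_ge0.
move=> /allP uu; apply/eqP/rowP => j.
by rewrite mxE; apply/eqP; have := uu j; rewrite mem_index_enum mulf_eq0 orbb; exact.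
Qed.

Lemma le_coord_norm u j : `|u ord0 j| <= `|u|.
Proof.
rewrite [leRHS]/Num.norm/= mx_normrE.
by apply/bigmax_geP; right; exists (ord0, j).
Qed.

Lemma ler_norm_dotv u v : `|dotv u v| <= (\sum_j `|u ord0 j|) * `|v|.
Proof.
rewrite mulr_suml; apply: (le_trans (ler_norm_sum _ _ _)); apply: ler_sum => j _.
by rewrite normrM ler_wpM2l// le_coord_norm.
Qed.

End Dot.

Section Norm.
Context {R : realType} {n : nat} {nrm : 'rV[R]_n -> R} (nrmP : is_norm nrm).

Lemma nrm_ge0 x : 0 <= nrm x. Proof. by case: nrmP. Qed.

Lemma nrmZ k x : nrm (k *: x) = `|k| * nrm x. Proof. by case: nrmP. Qed.

Lemma nrm_triangle x y : nrm (x + y) <= nrm x + nrm y.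
Proof. by case: nrmP. Qed.

Lemma nrm0 : nrm 0 = 0.
Proof. by rewrite -(scale0r 0) nrmZ normr0 mul0r. Qed.

Lemma nrmN x : nrm (- x) = nrm x.
Proof. by rewrite -scaleN1r nrmZ normrN normr1 mul1r. Qed.

Lemma nrm_gt0 x : x != 0 -> 0 < nrm x.
Proof.
move=> x0; rewrite lt_def nrm_ge0 andbT; apply: contra x0 => /eqP.
by case: nrmP => _ + _ _ => /[apply] ->.
Qed.

Lemma nrm_le_sup_norm : exists C, forall x, nrm x <= C * `|x|.
Proof.
exists (\sum_j nrm (delta_mx ord0 j)) => x.
rewrite {1}[x]row_sum_delta mulr_suml.
elim/big_ind2 : _ => [|a b c d ab cd|j _]; first by rewrite nrm0.
- exact: le_trans (nrm_triangle _ _) (lerD ab cd).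
- by rewrite nrmZ mulrC ler_wpM2l ?nrm_ge0// le_coord_norm.
Qed.

Lemma nrm_continuous : continuous nrm.
Proof.
have [C nrmC] := nrm_le_sup_norm; move=> x.
have C0 : 0 < `|C| + 1 by rewrite ltr_wpDl.
apply/(@cvgrPdist_lt _ R^o _ (nbhs x)) => e e0; apply/nbhs_ballP.
exists ((`|C| + 1)^-1 * e) => [|y]; first by rewrite /= mulr_gt0// invr_gt0.
rewrite -ball_normE /= ltr_pdivlMl// => xy.
apply: (@le_lt_trans _ _ (nrm (x - y))).
  have := nrm_triangle (x - y) y; have := nrm_triangle (y - x) x.
  rewrite !subrK -(nrmN (y - x)) opprB ler_norml; lra.
apply: le_lt_trans xy; apply: le_trans (nrmC _) _.
by rewrite ler_wpM2r// (le_trans (ler_norm _))// lerDl.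
Qed.

(** All norms are equivalent in finite dimension: [nrm] is continuous, so on the
    compact unit sphere of the sup norm it attains its minimum, which is
    positive since [nrm] vanishes only at the origin. *)
Lemma sup_norm_le_nrm : exists2 c, 0 < c & forall x, c * `|x| <= nrm x.
Proof.
pose S := [set x : 'rV[R]_n | `|x| = 1].
have scaled x : x != 0 -> S (`|x|^-1 *: x).
  by move=> x0; rewrite /S /= normrZ normfV normr_id mulVf// normr_eq0.
have [[x0 Sx0]|S0] := pselect (S !=set0); last first.
  exists 1 => // x; have [->|xN0] := eqVneq x 0; first by rewrite nrm0 normr0 mulr0.
  by case: S0; exists (`|x|^-1 *: x); exact: scaled.
have cS : compact S.
  apply: bounded_closed_compact.
    by exists 1; split => // r r1 x /= ->; exact: ltW.
  have -> : S = (fun x => `|x|) @^-1` [set 1] by [].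
  apply: closed_comp; last exact: closed_eq.
  by move=> x _; exact: norm_continuous.
have [x1 /[!inE] Sx1 x1min] := EVT_min_rV (ex_intro _ _ Sx0) cS
  (continuous_subspaceT nrm_continuous).
have x1N0 : x1 != 0 by rewrite -normr_eq0 Sx1 oner_eq0.
exists (nrm x1); first exact: nrm_gt0.
move=> x; have [->|xN0] := eqVneq x 0; first by rewrite nrm0 normr0 mulr0.
have := x1min (`|x|^-1 *: x); rewrite inE => /(_ (scaled _ xN0)).
by rewrite nrmZ normfV normr_id mulrC ler_pdivlMr ?normr_gt0// mulrC.
Qed.

Let dual_set y := [set dotv y x | x in [set x | nrm x <= 1]].

Lemma dual_norm_has_ubound y : has_ubound (dual_set y).
Proof.
have [c c0 cle] := sup_norm_le_nrm.
exists ((\sum_j `|y ord0 j|) * c^-1) => _ [x /= x1 <-].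
apply: le_trans (ler_norm _) (le_trans (ler_norm_dotv _ _) _).
by rewrite ler_wpM2l ?sumr_ge0// -[leRHS]mulr1 ler_pdivlMl// (le_trans (cle x)).
Qed.

Lemma dual_norm_gt0 y : y != 0 -> 0 < dual_norm nrm y.
Proof.
move=> y0; apply: (@lt_le_trans _ _ ((nrm y)^-1 * dotv y y)).
  by rewrite mulr_gt0 ?invr_gt0 ?nrm_gt0 ?dotv_gt0.
apply: (ub_le_sup (dual_norm_has_ubound y)); exists ((nrm y)^-1 *: y) => /=.
  by rewrite nrmZ normfV ger0_norm ?nrm_ge0// mulVf// gt_eqF ?nrm_gt0.
by rewrite dotvZr.
Qed.

(** Hoelder's inequality. It needs the supremum defining the dual norm to be finite,
    which is where the equivalence of norms enters. *)
Lemma dotv_le_dual_norm y x : dotv y x <= dual_norm nrm y * nrm x.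
Proof.
have [->|x0] := eqVneq x 0.
  by rewrite nrm0 mulr0 -(scale0r 0) dotvZr mul0r.
rewrite -ler_pdivrMr ?nrm_gt0// mulrC -dotvZr.
apply: (ub_le_sup (dual_norm_has_ubound y)); exists ((nrm x)^-1 *: x) => //=.
by rewrite nrmZ normfV ger0_norm ?nrm_ge0// mulVf// gt_eqF ?nrm_gt0.
Qed.

(** Directions along which the distance to a half-space is nearly realized. *)
Lemma dual_norm_approx y r : r < dual_norm nrm y ->
  exists2 u, nrm u <= 1 & r < dotv y u.
Proof.
move=> /sup_gt[|_ [u u1 <-] ru]; last by exists u.
by exists (dotv y 0), 0 => //=; rewrite nrm0.
Qed.

End Norm.

(** * The fractional knapsack problem *)

(** The optimum is greedy: fill the cheapest items until the load [e] is reached.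
    The critical cost [t = d j] is a quantile: the items strictly cheaper than [t]
    do not exceed the load, whereas together with the ties at [t] they do. All
    cheaper items are taken in full and the ties with a common fraction, and then
    complementary slackness holds item by item. *)
Lemma knapsack_strong_duality {R : realType} {N : nat} (d : 'I_N -> R) (e : R) :
  0 < e -> e < N%:R ->
  exists t (w : 'I_N -> R), [/\ forall i, 0 <= w i <= 1, \sum_i w i = e
    & \sum_i w i * d i = e * t - \sum_i Num.max 0 (t - d i)].
Proof.
move=> e0 eN.
have N0 : (0 < N)%N by rewrite -(ltr0n R) (lt_trans e0).
pose upto j : R := \sum_i (d i <= d j)%R%:R.
have [jmax _ jmaxP] := arg_maxP d (erefl : xpredT (Ordinal N0)).
have Pmax : e < upto jmax.
  rewrite /upto (eq_bigr (fun=> 1)) ?sumr_const ?card_ord// => i _.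
  by have /= -> := jmaxP i isT.
have [j Pj jmin] := arg_minP d (Pmax : [pred j | e < upto j] jmax).
pose below : R := \sum_i (d i < d j)%R%:R.
pose ties : R := \sum_i (d i == d j)%R%:R.
have uptoE : upto j = below + ties.
  rewrite -big_split/=; apply: eq_bigr => i _.
  by case: (ltgtP (d i) (d j)) => _; rewrite ?addr0 ?add0r.
have below_le : below <= e.
  rewrite leNgt; apply/negP => e_below.
  have [k0 k0j] : exists k, d k < d j.
    apply/existsP; apply: contraTT e_below; rewrite negb_exists => /forallP noj.
    by rewrite -leNgt /below big1 ?ltW// => i _; rewrite (negbTE (noj i)).
  have [k kj kmax] := arg_maxP d (k0j : [pred k | d k < d j] k0).
  suff /jmin /= : e < upto k by rewrite leNgt; move/negP; apply.
  rewrite (lt_le_trans e_below)// ler_sum// => i _.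
  by rewrite ler_nat; case: (ltP (d i) (d j)) => // /kmax /= ->.
have ties0 : 0 < ties by rewrite -(ltrD2l below) addr0 -uptoE (le_lt_trans below_le).
pose l := (e - below) / ties.
have l01 : 0 <= l <= 1.
  rewrite divr_ge0 ?subr_ge0 ?(ltW ties0)//= ler_pdivrMr// mul1r lerBlDl -uptoE.
  exact: ltW.
pose w i := (d i < d j)%R%:R + l * (d i == d j)%R%:R.
have sw : \sum_i w i = e.
  by rewrite big_split/= -mulr_sumr -/below -/ties mulfVK ?gt_eqF// subrKC.
exists (d j), w; split => //.
  move=> i; rewrite /w.
  by case: (ltgtP (d i) (d j)) => _; rewrite ?mulr0 ?mulr1 ?addr0 ?add0r ?lexx ?ler01.
rewrite -sw mulr_suml -sumrB; apply: eq_bigr => i _; rewrite /w.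
case: (ltgtP (d i) (d j)) => ij /=.
- by rewrite max_r ?subr_ge0 ?ltW//; ring.
- by rewrite max_l ?subr_le0 ?ltW//; ring.
- by rewrite ij subrr maxxx; ring.
Qed.

(** If every dual value is below [c], the optimal load [e] costs strictly less than
    [c]; as [e] is below the capacity [N], shifting [w] slightly towards the all-ones
    vector increases the load strictly while the cost stays below [c]. *)
Lemma knapsack_overload {R : realType} {N : nat} (d : 'I_N -> R) (e c : R) :
  (forall i, 0 <= d i) -> 0 < e -> e < N%:R ->
  (forall t, e * t - \sum_i Num.max 0 (t - d i) < c) ->
  exists w : 'I_N -> R,
    [/\ forall i, 0 <= w i <= 1, e < \sum_i w i & \sum_i w i * d i < c].
Proof.
move=> d0 e0 eN dual_lt; have [t [w [w01 sw swd]]] := knapsack_strong_duality d e e0 eN.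
have {dual_lt} gap : 0 < c - \sum_i w i * d i by rewrite subr_gt0 swd.
have D0 : 0 < \sum_i d i + 1 by rewrite ltr_wpDl ?sumr_ge0.
(* At this step size the extra cost [del * sum d] stays below the gap, the [+ 1]
   making the inequality strict and the denominator nonzero. *)
pose del := Num.min 1 ((c - \sum_i w i * d i) / (\sum_i d i + 1)).
have del0 : 0 < del by rewrite lt_min ltr01 divr_gt0.
have del1 : del <= 1 by rewrite ge_min lexx.
exists (fun i => w i + del * (1 - w i)); split.
- move=> i; have /andP[w0 w1] := w01 i; apply/andP; split; first by nra.
  by rewrite -lerBrDl ler_piMl// subr_ge0.
- rewrite big_split/= -mulr_sumr sumrB sumr_const card_ord sw ltrDl.
  by rewrite mulr_gt0// subr_gt0.
- under eq_bigr do rewrite mulrDl; rewrite big_split/= -ltrBrDl.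
  apply: (@le_lt_trans _ _ (del * \sum_i d i)).
    rewrite mulr_sumr; apply: ler_sum => i _.
    have /andP[w0 w1] := w01 i; rewrite ler_wpM2r// ger_pMr// ; lra.
  apply: (@lt_le_trans _ _ (del * (\sum_i d i + 1))); first by rewrite ltr_pM2l// ltrDl.
  by rewrite -ler_pdivlMr// ge_min lexx orbT.
Qed.

(** * Integration and finitely supported distributions *)

Section Integration.
Local Open Scope ereal_scope.
Context {d : measure_display} {T : measurableType d} {R : realType}.
Import HBNNSimple.

(** The integral of a nonnegative function is a supremum over the simple functions
    below it, so this bound and the next one hold even when [f] is not measurable;
    they are applied to the transport cost. *)
Lemma ge0_integral_le_of_simple (mu : {measure set T -> \bar R}) (f : T -> R) M :
  (forall x, 0 <= f x)%R ->
  (forall h : {nnsfun T >-> R}, (forall x, h x <= f x)%R ->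
    \int[mu]_x (h x)%:E <= M) ->
  \int[mu]_x (f x)%:E <= M.
Proof.
move=> f0 hM; rewrite ge0_integralTE; last by move=> x; rewrite lee_fin.
apply/ge_ereal_sup => _ [h /= hf <-].
have := hM h (fun x => _ : (h x <= f x)%R); rewrite integral_nnsfun// patch_setT.
by apply => x; rewrite -lee_fin.
Qed.

Lemma ge0_le_integral_of_measurable (mu : {measure set T -> \bar R})
    (h f : T -> R) : (forall x, 0 <= h x)%R -> measurable_fun setT h ->
  (forall x, h x <= f x)%R -> \int[mu]_x (h x)%:E <= \int[mu]_x (f x)%:E.
Proof.
move=> h0 mh hf; have f0 x : (0 <= f x)%R := le_trans (h0 x) (hf x).
rewrite ge0_integralTE; last by move=> x; rewrite lee_fin.
rewrite ge0_integralTE; last by move=> x; rewrite lee_fin.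
apply/ereal_sup_le => _ [g /= gh <-]; exists g => // x.
by rewrite (le_trans (gh x))// lee_fin.
Qed.

Lemma ex_probability (mu : {measure set T -> \bar R}) : mu setT = 1 ->
  exists P : probability T R, forall A, P A = mu A.
Proof.
move=> mu1.
have [x _] : [set: T] !=set0.
  by apply/set0P/eqP => T0; move: mu1; rewrite T0 measure0 => /esym/eqP; rewrite onee_eq0.
exists (mnormalize mu (\d_x : probability T R)) => A.
by rewrite /= /mnormalize mu1 onee_eq0 /= invr1 mule1.
Qed.

(** A mixture of Dirac masses. For the integral, equality holds for measurable [f];
    only the upper bound survives in general. *)
Lemma finite_mixture {I : finType} (p : I -> R) (z : I -> T) :
  (forall i, 0 <= p i)%R -> (\sum_i p i = 1)%R ->
  exists P : probability T R,
    (forall A, P A = (\sum_i p i * \1_A (z i))%:E) /\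
    (forall f : T -> R, (forall x, 0 <= f x)%R ->
      \int[P]_x (f x)%:E <= (\sum_i p i * f (z i))%:E).
Proof.
move=> p0 p1.
have [i0 _] : exists i0 : I, true.
  case: (pickP (fun _ : I => true)) => [i0 _|noI]; first by exists i0.
  by move: p1; rewrite big_pred0// => /esym/eqP; rewrite oner_eq0.
pose e k := nth i0 (enum I) k.
have sum_e (F : I -> \bar R) : \sum_(k < #|I|) F (e k) = \sum_i F i.
  by rewrite -[RHS](big_enum _ _ I F) (big_nth i0) big_mkord cardE.
pose mu : {measure set T -> \bar R} :=
  msum (fun k => mscale (NngNum (p0 (e k))) \d_(z (e k))) #|I|.
have muE A : mu A = (\sum_i p i * \1_A (z i))%:E.
  rewrite /mu /= /msum /mscale /=.
  rewrite (sum_e (fun i => (p i)%:E * \d_(z i) A)) -sumEFin.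
  by apply: eq_bigr => i _; rewrite EFinM.
have [P PE] : exists P : probability T R, forall A, P A = mu A.
  apply: ex_probability; rewrite muE -p1; congr EFin; apply: eq_bigr => i _.
  by rewrite indicT mulr1.
exists P; split => [A|f f0]; first by rewrite PE.
have -> : \int[P]_x (f x)%:E = \int[mu]_x (f x)%:E.
  by apply: eq_measure_integral => A _ _; exact: PE.
apply: ge0_integral_le_of_simple => // h hf.
have h0 x : 0 <= (h x)%:E by rewrite lee_fin.
have mh : measurable_fun setT (fun x => (h x)%:E) by exact/measurable_EFinP.
rewrite ge0_integral_measure_sum//.
under eq_bigr do rewrite ge0_integral_mscale//= integral_dirac// diracT mul1e.
rewrite (sum_e (fun i => (p i)%:E * (h (z i))%:E)) -sumEFin.
by apply: lee_sum => i _; rewrite lee_fin ler_wpM2l.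
Qed.

End Integration.

Lemma measurable_bigmin {d : measure_display} {T : measurableType d} {R : realType}
    {I : Type} (D : set T) (s : seq I) (f : T -> R) (F : I -> T -> R) :
  measurable_fun D f -> (forall i, measurable_fun D (F i)) ->
  measurable_fun D (fun x => \big[Num.min/f x]_(i <- s) F i x).
Proof.
move=> mf mF; elim: s => [|i s ih]; first by under eq_fun do rewrite big_nil.
by under eq_fun do rewrite big_cons; exact: measurable_minr.
Qed.

Lemma measurable_coord {R : realType} {n : nat} (j : 'I_n) :
  measurable_fun setT (fun x : borel_space R n => (x : 'rV[R]_n) ord0 j).
Proof.
apply: (measurability _ (RGenOpens.measurableE R)) => _ [_ [u [v ->]] <-].
rewrite setTI; apply: sub_sigma_algebra.
apply: (@open_comp _ _ (fun x : 'rV[R]_n => x ord0 j)).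
  by move=> x _; exact: coord_continuous.
exact: itv_open.
Qed.

(** * Transport from a distribution to the sample *)

(** Weak duality for optimal transport with the indicator of [U] as the payoff: the
    hypothesis on [t] says that [t] times the indicator of [U] is at most [c + g].
    To integrate it, [c] is replaced by its measurable minorant [h], the positive
    part of the difference of that payoff and [g]. *)
Lemma coupling_integral_lb {R : realType} {n : nat}
    (P1 P2 : probability (borel_space R n) R)
    (pi : probability (borel_space R n * borel_space R n)%type R)
    (U : set (borel_space R n)) (g : borel_space R n -> R) (t : R)
    (c : borel_space R n * borel_space R n -> R) :
  couplings P1 P2 pi -> measurable U -> measurable_fun setT g ->
  (forall x, 0 <= g x) -> 0 <= t -> (forall z, 0 <= c z) ->
  (forall z, U z.1 -> t <= c z + g z.2) ->
  (t%:E * P1 U <= \int[pi]_z (c z)%:E + \int[P2]_x (g x)%:E)%E.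
Proof.
move=> piP mU mg g0 t0 c0 tcg.
have mU1 : measurable (fst @^-1` U : set (borel_space R n * borel_space R n)).
  by rewrite -[X in measurable X]setTI; exact: measurable_fst.
pose i (z : borel_space R n * borel_space R n) : R := t * \1_(fst @^-1` U) z.
have mi : measurable_fun setT i by apply: measurable_funM => //; exact: measurable_indic.
have mg2 : measurable_fun setT (g \o snd : borel_space R n * borel_space R n -> R).
  by apply: measurableT_comp => //; exact: measurable_snd.
pose h z := Num.max 0 (i z - g z.2).
have h0 z : 0 <= h z by rewrite le_max lexx.
have mh : measurable_fun setT h.
  by apply: measurable_maxr => //; exact: measurable_funB.
have hc z : h z <= c z.
  rewrite ge_max c0 lerBlDr /i indicE; case: (boolP (z \in _)) => [/set_mem Uz|_].
  - by rewrite mulr1 tcg.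
  - by rewrite mulr0 addr_ge0.
have -> : (t%:E * P1 U = \int[pi]_z (i z)%:E)%E.
  under eq_integral do rewrite EFinM.
  rewrite ge0_integralZl//; last exact/measurable_EFinP/measurable_indic.
  rewrite integral_indic// setIT; congr (_ * _)%E.
  by have [<- _] := piP _ mU.
apply: (@le_trans _ _ (\int[pi]_z ((h z)%:E + (g z.2)%:E))%E).
  apply: ge0_le_integral => //.
  - by move=> z _; rewrite lee_fin mulr_ge0.
  - exact/measurable_EFinP.
  - by apply/measurable_EFinP; exact: measurable_funD.
  - by move=> z _; rewrite -EFinD lee_fin -lerBlDr le_max lexx orbT.
rewrite ge0_integralD//; last 4 first.
- by move=> z _; rewrite lee_fin.
- exact/measurable_EFinP.
- by move=> z _; rewrite lee_fin.
- exact/measurable_EFinP.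
apply: leeD; first exact: ge0_le_integral_of_measurable.
have -> : (\int[P2]_x (g x)%:E = \int[pushforward pi snd]_x (g x)%:E)%E.
  by apply: eq_measure_integral => A mA _; have [_ /esym] := piP _ mA.
rewrite ge0_integral_pushforward//.
- exact/measurable_EFinP.
- by move=> x _; rewrite lee_fin.
Qed.

Lemma integral_empirical {R : realType} {n N : nat} (N0 : (0 < N)%N)
    (xihat : 'I_N -> 'rV[R]_n) (g : borel_space R n -> R) :
  measurable_fun setT g -> (forall x, 0 <= g x) ->
  (\int[empirical N0 xihat]_x (g x)%:E = (N%:R^-1 * \sum_i g (xihat i))%:E)%E.
Proof.
move=> mg g0.
have g0' x : setT x -> (0 <= (g x)%:E)%E by rewrite lee_fin.
have mg' := (measurable_EFinP _ _).2 mg.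
pose mu := mscale (NngNum (eqbRL (invr_ge0 N%:R) (ler0n R N)))
  (msum (fun k => \d_(xihat (insubd (Ordinal N0) k) : borel_space R n)) N).
transitivity (\int[mu]_x (g x)%:E)%E.
  apply: eq_measure_integral => A _ _.
  exact: (congr1 (@^~ A) (empirical_mscale N0 xihat)).
rewrite ge0_integral_mscale// ge0_integral_measure_sum// EFinM -sumEFin.
congr (_ * _)%E; apply: eq_bigr => i _.
by rewrite integral_dirac// diracT mul1e valKd.
Qed.

(** * Distance to a union of half-spaces *)

Section PolyhedralDistance.
Context {R : realType} {K M : nat} (nrm : 'rV[R]_K -> R) (nrmP : is_norm nrm).
Context (M0 : (0 < M)%N) (b : 'I_M -> 'rV[R]_K) (b_neq0 : forall m, b m != 0).
Context (h : 'I_M -> R).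

Definition margin (m : 'I_M) (xi : 'rV[R]_K) : R :=
  (dotv (b m) xi + h m) / dual_norm nrm (b m).

(** The distance from [xi] to [unsafe_set], in closed form. The default value of the
    minimum is one of its terms and hence does not affect it. *)
Definition unsafe_dist (xi : 'rV[R]_K) : R :=
  \big[Num.min/Num.max 0 (margin (Ordinal M0) xi)]_m Num.max 0 (margin m xi).

Definition unsafe_set : set (borel_space R K) :=
  [set xi | exists m, dotv (b m) xi + h m <= 0].

Let D_gt0 m : 0 < dual_norm nrm (b m). Proof. exact: dual_norm_gt0. Qed.

Lemma margin_le0 m xi : (margin m xi <= 0) = (dotv (b m) xi + h m <= 0).
Proof. by rewrite /margin ler_pdivrMr// mul0r. Qed.

Lemma unsafe_dist_attained xi : exists m, unsafe_dist xi = Num.max 0 (margin m xi).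
Proof.
rewrite /unsafe_dist; elim/big_ind : _ => [|_ _ [m ->] [m' ->]|m _].
- by exists (Ordinal M0).
- by rewrite /Num.min; case: ifP => _; [exists m|exists m'].
- by exists m.
Qed.

Lemma unsafe_dist_ge0 xi : 0 <= unsafe_dist xi.
Proof. by have [m ->] := unsafe_dist_attained xi; rewrite le_max lexx. Qed.

Lemma unsafe_dist_le m xi : unsafe_dist xi <= Num.max 0 (margin m xi).
Proof. exact: bigmin_le_cond. Qed.

Lemma unsafe_dist_le0 xi : unsafe_set xi <-> unsafe_dist xi <= 0.
Proof.
split=> [[m mxi]|].
- by rewrite (le_trans (unsafe_dist_le m xi))// ge_max lexx margin_le0.
- have [m ->] := unsafe_dist_attained xi; rewrite ge_max lexx margin_le0.
  by exists m.
Qed.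

Lemma measurable_unsafe_dist :
  measurable_fun setT (unsafe_dist : borel_space R K -> R).
Proof.
suff mm m : measurable_fun setT (fun xi : borel_space R K => Num.max 0 (margin m xi)).
  rewrite /unsafe_dist; apply: measurable_bigmin => // m; exact: mm.
apply: measurable_maxr => //; apply: measurable_funM => //.
apply: measurable_funD => //; apply: measurable_sum => j.
by apply: measurable_funM => //; exact: measurable_coord.
Qed.

Lemma measurable_unsafe_set : measurable unsafe_set.
Proof.
have -> : unsafe_set = setT `&` unsafe_dist @^-1` `]-oo, 0].
  rewrite setTI; apply/seteqP; split=> xi /=; rewrite in_itv/=.
  - by move/unsafe_dist_le0.
  - by move=> ?; apply/unsafe_dist_le0.
exact: measurable_unsafe_dist.
Qed.

(** If [y] violates the [m]-th condition, its [m]-th margin is nonpositive, and by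
    Hoelder's inequality margins are 1-Lipschitz for [nrm]. *)
Lemma unsafe_dist_lb (y xi : 'rV[R]_K) :
  unsafe_set y -> unsafe_dist xi <= nrm (y - xi).
Proof.
move=> [m my]; apply: (le_trans (unsafe_dist_le m xi)).
rewrite ge_max nrm_ge0//= /margin ler_pdivrMr// mulrC -(nrmN nrmP) opprB.
apply: le_trans (dotv_le_dual_norm nrmP _ _).
by rewrite dotvDr dotvNr; lra.
Qed.

(** Move from [xi] against a vector [u] of the unit ball that nearly attains the dual norm
    of the binding constraint [b m]. *)
Lemma unsafe_dist_approx (xi : 'rV[R]_K) (eta : R) : 0 < eta ->
  exists2 y : 'rV[R]_K, unsafe_set y & nrm (y - xi) <= unsafe_dist xi + eta.
Proof.
move=> eta0; have [m ->] := unsafe_dist_attained xi.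
have [mle0|mgt0] := leP (margin m xi) 0.
  exists xi; first by exists m; rewrite -margin_le0.
  by rewrite subrr nrm0// ltW// ltr_wpDl.
set v := margin m xi in mgt0 *; have ve0 : 0 < v + eta by rewrite addr_gt0.
(* The threshold is such that a step of length [v + eta] along [- u] decreases
   [dotv (b m)] by at least [||b m||_* * v], which closes the gap to the half-space. *)
have [|u u1 bu] := @dual_norm_approx _ _ _ nrmP (b m)
    (dual_norm nrm (b m) * (v / (v + eta))).
  by rewrite gtr_pMr// ltr_pdivrMr// mul1r ltrDl.
exists (xi - (v + eta) *: u).
  exists m; rewrite dotvDr dotvNr dotvZr addrAC subr_le0.
  have -> : dotv (b m) xi + h m = dual_norm nrm (b m) * v.
    by rewrite /v /margin mulrCA mulfV ?mulr1// gt_eqF.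
  by move: bu; rewrite mulrA ltr_pdivrMr// [_ * dotv _ _]mulrC => /ltW.
rewrite addrAC subrr add0r (nrmN nrmP) (nrmZ nrmP) gtr0_norm//.
by rewrite ler_piMr// ltW.
Qed.

End PolyhedralDistance.

(** * The worst-case probability of the unsafe set *)

Section WorstCase.
Context {R : realType} {K M N : nat} {nrm : 'rV[R]_K -> R} (nrmP : is_norm nrm).
Context (M0 : (0 < M)%N) {b : 'I_M -> 'rV[R]_K} (b_neq0 : forall m, b m != 0).
Context (h : 'I_M -> R) (N0 : (0 < N)%N) (xihat : 'I_N -> 'rV[R]_K).
Context {theta eps : R} (theta0 : 0 < theta) (eps0 : 0 < eps) (eps1 : eps < 1).

Let dist := unsafe_dist nrm M0 b h.
Let U := unsafe_set b h.
Let N_gt0 : 0 < N%:R :> R. Proof. by rewrite ltr0n. Qed.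

(** Weak duality between the transport problem and the pair [(t, s)]. *)
Lemma unsafe_probability_le (t : R) (s : 'I_N -> R)
    (P : probability (borel_space R K) R) :
  (forall i, 0 <= s i) -> (forall i, t - s i <= dist (xihat i)) ->
  theta * N%:R <= eps * N%:R * t - \sum_i s i ->
  ambiguity_set nrm N0 xihat theta P -> (P U <= eps%:E)%E.
Proof.
move=> s0 ts dual_ge Pamb.
have t0 : 0 < t.
  have : 0 < eps * N%:R * t.
    rewrite (lt_le_trans (mulr_gt0 theta0 N_gt0))// (le_trans dual_ge)//.
    by rewrite gerBl sumr_ge0.
  by rewrite pmulr_rgt0// mulr_gt0.
pose g (xi : borel_space R K) : R := Num.max 0 (t - dist xi).
have g0 xi : 0 <= g xi by rewrite le_max lexx.
have mg : measurable_fun setT g.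
  by apply: measurable_maxr => //; apply: measurable_funB => //; exact: measurable_unsafe_dist.
have mU : measurable U by exact: (measurable_unsafe_set nrm nrmP M0 b b_neq0 h).
have gs : N%:R^-1 * \sum_i g (xihat i) <= eps * t - theta.
  rewrite ler_pdivrMl// mulrBr.
  apply: (@le_trans _ _ (\sum_i s i)); last by lra.
  by apply: ler_sum => i _; rewrite ge_max s0/= lerBlDl -lerBlDr ts.
have PUfin : P U \is a fin_num by exact: fin_num_measure.
suff : (t%:E * P U - (eps * t - theta)%:E <= theta%:E)%E.
  rewrite -(fineK PUfin) -EFinM -EFinB !lee_fin => le.
  by rewrite -(ler_pM2l t0); lra.
apply: le_trans Pamb; apply: le_ereal_inf_tmp => _ [pi piP <-].
rewrite unlock leeBlDr//.
apply: le_trans (coupling_integral_lb _ _ _ _ g t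
  (fun z => nrm ((z.1 : 'rV[R]_K) - (z.2 : 'rV[R]_K))) piP mU mg g0 (ltW t0) _ _) _.
- by move=> z; exact: (nrm_ge0 nrmP).
- move=> z Uz; apply: (@le_trans _ _ (dist z.2 + g z.2)).
    by rewrite -lerBlDl le_max lexx orbT.
  by rewrite lerD2r; apply: unsafe_dist_lb.
by rewrite leeD2l// integral_empirical// lee_fin.
Qed.

(** The adversarial distribution moves a share [w i] of the [i]-th atom to a point
    [y i] of the unsafe set and leaves the rest in place. *)
Lemma unsafe_probability_gt :
  (forall t, eps * N%:R * t - \sum_i Num.max 0 (t - dist (xihat i)) < theta * N%:R) ->
  exists2 P : probability (borel_space R K) R,
    ambiguity_set nrm N0 xihat theta P & (eps%:E < P U)%E.
Proof.
move=> dual_lt.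
have epsN : eps * N%:R < N%:R by rewrite gtr_pMl.
have [w [w01 epsw wd]] := knapsack_overload (fun i => dist (xihat i)) _ _
  (fun i => unsafe_dist_ge0 _ _ _ _ _) (mulr_gt0 eps0 N_gt0) epsN dual_lt.
(* The whole remaining budget is spent on the suboptimality of the [y i]. *)
pose eta := (theta * N%:R - \sum_i w i * dist (xihat i)) / N%:R.
have eta0 : 0 < eta by rewrite divr_gt0// subr_gt0.
have /choice[y yP] : forall i, exists y : 'rV[R]_K,
    U y /\ nrm (y - xihat i) <= dist (xihat i) + eta.
  move=> i; have [y Uy dy] := unsafe_dist_approx nrm nrmP M0 b b_neq0 h (xihat i) eta eta0.
  by exists y.
(* The pair [(i, true)] indexes the part of the [i]-th atom that moves and
   [(i, false)] the part that stays. *)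
pose p (ik : 'I_N * bool) := N%:R^-1 * (if ik.2 then w ik.1 else 1 - w ik.1).
pose z (ik : 'I_N * bool) : borel_space R K * borel_space R K :=
  (if ik.2 then y ik.1 else xihat ik.1, xihat ik.1).
have sum_split (F : 'I_N -> bool -> R) :
    \sum_ik p ik * F ik.1 ik.2 =
    N%:R^-1 * \sum_i (w i * F i true + (1 - w i) * F i false).
  rewrite -(pair_bigA _ (fun i k => p (i, k) * F i k))/= mulr_sumr.
  by apply: eq_bigr => i _; rewrite big_bool /p/=; ring.
have p0 ik : 0 <= p ik.
  have /andP[? ?] := w01 ik.1.
  by rewrite mulr_ge0 ?invr_ge0//; case: ifP; rewrite ?subr_ge0.
have p1 : \sum_ik p ik = 1.
  transitivity (\sum_ik p ik * 1); first by apply: eq_bigr => ik _; rewrite mulr1.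
  rewrite (sum_split (fun _ _ => 1)) (eq_bigr (fun=> 1)); last by move=> i _; ring.
  by rewrite sumr_const card_ord mulVf ?gt_eqF.
have [P [PE _]] := finite_mixture p (fst \o z) p0 p1.
have [pi [piE pi_le]] := finite_mixture p z p0 p1.
exists P; last first.
  rewrite PE lte_fin (sum_split (fun i k => \1_U (if k then y i else xihat i))).
  rewrite -ltr_pdivrMl ?invr_gt0// invrK mulrC (lt_le_trans epsw)// ler_sum// => i _.
  have [Uy _] := yP i; have /andP[w0 w1] := w01 i.
  rewrite [\1_U (y i)]indicE mem_set// mulr1 lerDl mulr_ge0 ?subr_ge0//.
have piP : couplings P (empirical N0 xihat) pi.
  move=> A mA; split; first by rewrite /pushforward piE PE.
  rewrite /pushforward piE (sum_split (fun i k => \1_A (xihat i))).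
  rewrite EFinM -sumEFin; congr (_ * _)%E; apply: eq_bigr => i _.
  by rewrite -mulrDl subrKC mul1r.
apply: ereal_inf_le; exists 'E_pi[fun z => nrm ((z.1 : 'rV[R]_K) - (z.2 : 'rV[R]_K))%R]%E.
  by exists pi.
rewrite unlock; apply: le_trans (pi_le _ _) _; first by move=> ?; exact: (nrm_ge0 nrmP).
rewrite lee_fin (sum_split (fun i k => nrm ((if k then y i else xihat i) - xihat i))).
rewrite ler_pdivrMl// mulrC.
apply: (@le_trans _ _ (\sum_i (w i * dist (xihat i) + eta))).
  apply: ler_sum => i _; rewrite subrr (nrm0 nrmP) mulr0 addr0.
  have [_ yi] := yP i; have /andP[wi0 wi1] := w01 i.
  by apply: le_trans (ler_wpM2l wi0 yi) _; nra.
rewrite big_split/= sumr_const card_ord -[eta *+ N]mulr_natr /eta divfK ?gt_eqF//; lra.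
Qed.

End WorstCase.

(** * The mixed integer reformulation *)

(** On a compact set of decisions all margins of all samples are bounded by one
    constant. The leading [1 +] in the witness only makes it positive. *)
Lemma bounded_margins {R : realType} {K L N M : nat} {nrm : 'rV[R]_K -> R}
    (xihat : 'I_N -> 'rV[R]_K) (X : set 'rV[R]_L)
    (a : 'I_M -> 'rV[R]_L) (b : 'I_M -> 'rV[R]_K) (beta : 'I_M -> R) :
  compact X ->
  exists2 V : R, 0 < V & forall x m i, X x ->
    `|margin nrm b (fun m => beta m - dotv (a m) x) m (xihat i)| <= V.
Proof.
move=> /compact_bounded [B [_ XB]].
have {}XB x : X x -> `|x| <= `|B| + 1.
  by move=> Xx; apply: (XB (`|B| + 1)) => //; rewrite (le_lt_trans (ler_norm _))// ltrDl.
pose v (m : 'I_M) (i : 'I_N) :=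
  (`|dotv (b m) (xihat i)| + `|beta m| + (\sum_j `|a m ord0 j|) * (`|B| + 1))
    / `|dual_norm nrm (b m)|.
have v0 m i : 0 <= v m i.
  by rewrite divr_ge0// !addr_ge0// mulr_ge0 ?addr_ge0// sumr_ge0.
exists (1 + \sum_m \sum_i v m i) => [|x m i Xx].
  by rewrite ltr_pwDl// sumr_ge0// => m _; rewrite sumr_ge0.
apply: (@le_trans _ _ (v m i)); last first.
  apply: ler_wpDl => //; rewrite (bigD1 m)//= (bigD1 i)//= -addrA lerDl.
  by rewrite addr_ge0// sumr_ge0// => m' _; rewrite sumr_ge0.
rewrite /margin /v normrM normfV ler_wpM2r ?invr_ge0//.
rewrite addrA (le_trans (ler_normB _ _))// lerD ?ler_normD//.
by rewrite (le_trans (ler_norm_dotv _ _))// ler_wpM2l ?sumr_ge0// XB.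
Qed.

Section Reformulation.
Context {R : realType} {K L N M : nat} {nrm : 'rV[R]_K -> R} (nrmP : is_norm nrm).
Context (N0 : (0 < N)%N) (xihat : 'I_N -> 'rV[R]_K) (X : set 'rV[R]_L).
Context {theta eps : R} (theta0 : 0 < theta) (eps0 : 0 < eps) (eps1 : eps < 1).
Context (M0 : (0 < M)%N) (a : 'I_M -> 'rV[R]_L) {b : 'I_M -> 'rV[R]_K}.
Context (b_neq0 : forall m, b m != 0) (beta : 'I_M -> R).

Let h x m := beta m - dotv (a m) x.
Let dist x i := unsafe_dist nrm M0 b (h x) (xihat i).

Lemma safety_setE x : safety_set a b beta x = ~` unsafe_set b (h x).
Proof.
apply/seteqP; split=> xi.
- by move=> safe [m]; have := safe m; rewrite /h; lra.
- move=> safe m; rewrite ltNge; apply/negP => unsafe.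
  by apply: safe; exists m; rewrite /h; lra.
Qed.

(** Strong duality: [unsafe_probability_le] and [unsafe_probability_gt] together show
    that the adversary fails exactly when a dual certificate [(t, s)] exists. *)
Lemma ccp_feasibleE x :
  ccp_feasible nrm N0 xihat X theta eps a b beta x <->
  X x /\ exists t (s : 'I_N -> R), [/\ theta * N%:R <= eps * N%:R * t - \sum_i s i,
    forall i, t - s i <= dist x i & forall i, 0 <= s i].
Proof.
have safe_unsafe (P : probability (borel_space R K) R) :
    ((1 - eps)%:E <= P (safety_set a b beta x))%E =
    (P (unsafe_set b (h x)) <= eps%:E)%E.
  have mU := measurable_unsafe_set nrm nrmP M0 b b_neq0 (h x).
  rewrite safety_setE probability_setC// EFinB.
  rewrite -(fineK (fin_num_measure P _ mU)) -!EFinB !lee_fin; lra.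
split=> [[Xx safe]|[Xx [t [s [dual_ge ts s0]]]]]; split=> //; last first.
  move=> P Pamb; rewrite safe_unsafe.
  exact: (unsafe_probability_le nrmP M0 b_neq0 (h x) N0 xihat theta0 eps0 t s).
apply: contrapT => no_dual.
have [t|P Pamb] := unsafe_probability_gt nrmP M0 b_neq0 (h x) N0 xihat
  (theta := theta) eps0 eps1.
  rewrite ltNge; apply/negP => dual_ge; apply: no_dual.
  exists t, (fun i => Num.max 0 (t - dist x i)); split => // i.
  - by rewrite lerBlDr -lerBlDl le_max lexx orbT.
  - by rewrite le_max lexx.
by rewrite ltNge -safe_unsafe safe.
Qed.

(** A solution of the program satisfies [t - s_i <= d_i] whatever [q_i] is: [q_i = 0]
    keeps the constraints [t - s_i <= margin], and [q_i = 1] keeps [t - s_i <= 0].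
    Conversely [q_i] is chosen to mark the samples that are already unsafe; the
    bound on the margins is what makes the switched-off constraints hold. *)
Lemma mip_feasibleE (bigM : R) x :
  (forall m i, X x -> `|margin nrm b (h x) m (xihat i)| <= bigM) ->
  (exists q s t,
    mip_feasible nrm xihat X theta eps a b beta bigM (MipVars q s t x)) <->
  X x /\ exists t (s : 'I_N -> R), [/\ theta * N%:R <= eps * N%:R * t - \sum_i s i,
    forall i, t - s i <= dist x i & forall i, 0 <= s i].
Proof.
move=> marginM.
have marginE m i :
    (dotv (b m) (xihat i) + beta m - dotv (a m) x) / dual_norm nrm (b m) =
    margin nrm b (h x) m (xihat i) by rewrite /margin /h addrA.
split=> [[q [s [t [dual_ge soft hard q01 [s0 Xx]]]]]|].
  split=> //; exists t, (s ord0); split=> // i.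
  have [qi|qi] := q01 i.
  - have [m dE] := unsafe_dist_attained nrm M0 b (h x) (xihat i).
    rewrite /dist dE; have := soft m i.
    by rewrite marginE qi mulr0 addr0 le_max => ->; rewrite orbT.
  - have := hard i; rewrite qi subrr mulr0 => /le_trans; apply.
    exact: unsafe_dist_ge0.
move=> [Xx [t [s [dual_ge ts s0]]]].
pose q i : R := ([exists m, margin nrm b (h x) m (xihat i) <= 0])%:R.
exists (\row_i q i), (\row_i s i), t; split.
- by under eq_bigr do rewrite mxE.
- move=> m i; rewrite !mxE marginE.
  have := marginM m i Xx; rewrite ler_norml => /andP[margin_ge _].
  apply: (le_trans (ts i)); rewrite /q; case: existsP => [[m' m'le]|noneg].
    apply: le_trans (unsafe_dist_le nrm M0 b (h x) m' _) _.
    by rewrite ge_max (le_trans m'le) mulr1; lra.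
  apply: le_trans (unsafe_dist_le nrm M0 b (h x) m _) _.
  rewrite mulr0 addr0 ge_max lexx andbT ltW// ltNge.
  by apply/negP => mle; apply: noneg; exists m.
- move=> i; rewrite !mxE; apply: (le_trans (ts i)); rewrite /q.
  case: existsP => [[m mle]|_].
    rewrite subrr mulr0; apply/unsafe_dist_le0 => //.
    by exists m; rewrite -(margin_le0 _ nrmP _ b_neq0).
  pose m := Ordinal M0.
  apply: le_trans (unsafe_dist_le nrm M0 b (h x) m _) _.
  have := marginM m i Xx => marginM'.
  rewrite subr0 mulr1 ge_max (le_trans _ marginM')//.
  by rewrite (le_trans (ler_norm _)).
- by move=> i; rewrite mxE /q; case: existsP; [right|left].
- by split=> // i; rewrite mxE.
Qed.

End Reformulation.

Theorem proposition2 (R : realType) (K L N M : nat)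
    (nrm : 'rV[R]_K -> R) (nrm_norm : is_norm nrm)
    (N0 : (0 < N)%N) (xihat : 'I_N -> 'rV[R]_K)
    (X : set 'rV[R]_L) (X_polyhedron : polyhedron X) (X_compact : compact X)
    (c : 'rV[R]_L)
    (theta eps : R) (theta0 : 0 < theta) (eps0 : 0 < eps) (eps1 : eps < 1)
    (M0 : (0 < M)%N) (a : 'I_M -> 'rV[R]_L) (b : 'I_M -> 'rV[R]_K)
    (b_neq0 : forall m : 'I_M, b m != 0) (beta : 'I_M -> R) :
  exists bigM0 : R, 0 < bigM0 /\
    forall bigM : R, bigM0 <= bigM ->
      let CCP := ccp_feasible nrm N0 xihat X theta eps a b beta in
      let MIP := mip_feasible nrm xihat X theta eps a b beta bigM in
      let ccp_obj := fun x : 'rV[R]_L => dotv c x in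
      let mip_obj := fun z : mip_vars R L N => dotv c (mip_x z) in
      [/\ forall x : 'rV[R]_L,
            CCP x <-> exists q s t, MIP (MipVars q s t x),
          optimal_value CCP ccp_obj = optimal_value MIP mip_obj
        & forall x : 'rV[R]_L,
            optimal_solution CCP ccp_obj x <->
            exists q s t, optimal_solution MIP mip_obj (MipVars q s t x)].
Proof.
have [V V0 marginV] := bounded_margins (nrm := nrm) xihat X a b beta X_compact.
exists V; split=> // bigM VM CCP MIP ccp_obj mip_obj.
have feasE x : CCP x <-> exists q s t, MIP (MipVars q s t x).
  apply: iff_trans (ccp_feasibleE nrm_norm _ _ _ theta0 eps0 eps1 M0 _ b_neq0 _ _) _.
  apply: iff_sym; apply: (mip_feasibleE nrm_norm) => // m i Xx.
  by rewrite (le_trans _ VM)// marginV.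
split=> //.
- congr ereal_inf; apply/seteqP; split=> v [].
  + by move=> x /feasE[q [s [t Mz]]] <-; exists (MipVars q s t x).
  + move=> [q s t x] Mz <-; exists x => //.
    by apply/feasE; exists q, s, t.
- move=> x; split=> [[/feasE[q [s [t Mz]]] xmin]|[q [s [t [Mz zmin]]]]].
  + exists q, s, t; split=> // -[q' s' t' x'] Mz'; apply: xmin.
    by apply/feasE; exists q', s', t'.
  + split; first by apply/feasE; exists q, s, t.
    by move=> x' /feasE[q' [s' [t' Mz']]]; exact: (zmin (MipVars q' s' t' x')).
Qed.
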